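(* Suppose that one of the following holds: (i) The conical hull of $(\operatorname{dom}f_1^*\times\cdots\times\operatorname{dom}f_m^* )-\Delta^\perp$ is a closed subspace. (ii) The function $X\ni d\mapsto f_1(d)+\cdots+f_m(d)$ is coercive and the conical hull of $(\operatorname{dom}f_1\times\cdots\times\operatorname{dom}f_m)-\Delta$ is a closed subspace. (iii) $\operatorname{dom}f_1^*\times\cdots\times\operatorname{dom}f_m^*=\mathbf{X}$. (iv) $f_1^*\oplus\cdots\oplus f_m^*$ is continuous at some point in $\Delta^\perp$. (v) $X$ is finite-dimensional and $(\operatorname{ri}\operatorname{dom}f_1^*\times\cdots\times\operatorname{ri}\operatorname{dom}f_m^* )\cap\Delta^\perp\neq\varnothing$. Then $\mathbf{f}\Box\iota_\Delta$ is proper, lower semicontinuous and convex, and exact on $\mathbf{X}$.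
   Context: $X$ is a real Hilbert space, $m\in\{1,2,\dots\}$, $\mathbf{X}=X^m$ is the product Hilbert space, $\Delta=\{(x,\dots,x):x\in X\}$ with orthogonal complement $\Delta^\perp$. $f_1,\dots,f_m$ are proper lower semicontinuous convex functions $X\to\,]-\infty,+\infty]$, $f_i^*$ is the Fenchel conjugate, $\mathbf{f}=f_1\oplus\cdots\oplus f_m$, where $(g_1\oplus\cdots\oplus g_m)(x_1,\dots,x_m)=\sum_i g_i(x_i)$. $\iota_\Delta$ is the indicator function of $\Delta$; $(\mathbf{f}\Box\iota_\Delta)(\mathbf{x})=\inf_{\mathbf{u}\in\mathbf{X}}(\mathbf{f}(\mathbf{u})+\iota_\Delta(\mathbf{x}-\mathbf{u}))$, and it is exact at $\mathbf{x}$ if this infimum is attained (exact on $\mathbf{X}$: at every point). A function $g$ is coercive if $g(x)\to+\infty$ as $\|x\|\to\infty$. $\operatorname{dom}g=\{x: g(x)<+\infty\}$; $\operatorname{ri}$ is the relative interior. The conical hull of $C$ is $\{\lambda c:\lambda>0,\ c\in C\}$. Continuity of a convex function at a point is meant at a point of its domain (so it is finite near that point). Standing assumption: $\operatorname{dom}\mathbf{f}^*\cap\Delta^\perp\neq\varnothing$. *)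

(* Defs.v *)
From HB Require Import structures.
From mathcomp Require Import all_boot all_order all_algebra.
From mathcomp Require Import all_classical all_reals all_analysis.
From mathcomp Require Import ring lra.

Set Implicit Arguments.
Unset Strict Implicit.
Unset Printing Implicit Defensive.

Import Order.TTheory GRing.Theory Num.Theory.
Import numFieldNormedType.Exports.

Local Open Scope classical_set_scope.
Local Open Scope ring_scope.

HB.mixin Record CompleteNormedModule_isHilbert (R : realType) X
    & CompleteNormedModule R X := {
  inner : X -> X -> R ;
  innerC : forall x y, inner x y = inner y x ;
  inner_linearl : forall y, scalar (fun x => inner x y) ;
  inner_norm : forall x, inner x x = `|x| ^+ 2
}.

#[short(type="hilbertType")]
HB.structure Definition Hilbert (R : realType) :=
  {X of CompleteNormedModule R X & CompleteNormedModule_isHilbert R X}.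

(* The inner product is a symmetric positive definite form in the sense of
   sesquilinear.v, so that the theory developed there applies to it. *)
Section inner_form.
Context (R : realType) (X : hilbertType R).

Let inner_bilinear : bilinear_for
  (GRing.Scale.Law.clone _ _ *%R _) (GRing.Scale.Law.clone _ _ (idfun \; *%R) _)
  (@inner R X).
Proof.
split=> [y|x]; first exact: inner_linearl.
by move=> a u v /=; rewrite !(innerC x); exact: inner_linearl.
Qed.

HB.instance Definition _ :=
  @bilinear_isBilinear.Build R X X R _ _ (@inner R X) inner_bilinear.

Let inner_hermitian (x y : X) :
  inner x y = (-1) ^+ false * (idfun : R -> R) (inner y x).
Proof. by rewrite expr0 mul1r innerC. Qed.

HB.instance Definition _ :=
  @isHermitianSesquilinear.Build R X false idfun (@inner R X) inner_hermitian.

Let inner_posdef (x : X) : x != 0 -> 0 < inner x x.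
Proof. by move=> x0; rewrite inner_norm exprn_gt0// normr_gt0. Qed.

HB.instance Definition _ := @isDotProduct.Build R X (@inner R X) inner_posdef.

End inner_form.

(* The product Hilbert space X^m, with inner product the sum of the
   componentwise inner products. *)
Definition prodH (R : realType) (X : hilbertType R) (m : nat) : Type :=
  {ffun 'I_m -> X}.

Section prodH_hilbert.
Context (R : realType) (X : hilbertType R) (m : nat).
Local Notation XX := (prodH X m).

HB.instance Definition _ := GRing.Lmodule.copy XX {ffun 'I_m -> X}.

Definition prodH_inner (x y : XX) : R := \sum_(i < m) inner (x i) (y i).

Definition prodH_norm (x : XX) : R := Num.sqrt (prodH_inner x x).

Let prodH_innerC x y : prodH_inner x y = prodH_inner y x.
Proof. by apply: eq_bigr => i _; rewrite innerC. Qed.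

Let prodH_inner_linearl y : scalar (fun x => prodH_inner x y).
Proof.
move=> a u v; rewrite /prodH_inner mulr_sumr -big_split /=.
by apply: eq_bigr => i _; rewrite !ffunE inner_linearl.
Qed.

Let prodH_innerxx_ge0 x : 0 <= prodH_inner x x.
Proof. by apply: sumr_ge0 => i _; rewrite inner_norm sqr_ge0. Qed.

Let prodH_norm_sqr x : prodH_norm x ^+ 2 = prodH_inner x x.
Proof. by rewrite sqr_sqrtr. Qed.

Let prodH_innerDl x y z :
  prodH_inner (x + y) z = prodH_inner x z + prodH_inner y z.
Proof. by have /= := prodH_inner_linearl z 1 x y; rewrite scale1r mul1r. Qed.

Let prodH_inner0l z : prodH_inner 0 z = 0.
Proof.
by apply: (@addrI _ (prodH_inner 0 z)); rewrite -prodH_innerDl !addr0.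
Qed.

Let prodH_innerZl a x z : prodH_inner (a *: x) z = a * prodH_inner x z.
Proof.
by have /= := prodH_inner_linearl z a x 0; rewrite prodH_inner0l !addr0.
Qed.

Let prodH_norm_ge0 x : 0 <= prodH_norm x.
Proof. exact: sqrtr_ge0. Qed.

Let component_le (x : XX) (i : 'I_m) : `|x i| <= prodH_norm x.
Proof.
rewrite -(@ler_pXn2r _ 2) ?nnegrE// prodH_norm_sqr /prodH_inner (bigD1 i)//=.
rewrite inner_norm lerDl; apply: sumr_ge0 => j _.
by rewrite inner_norm sqr_ge0.
Qed.

Let prodH_norm_le (x : XX) : prodH_norm x <= \sum_(i < m) `|x i|.
Proof.
have S0 : 0 <= \sum_(i < m) `|x i| by apply: sumr_ge0.
rewrite -(@ler_pXn2r _ 2) ?nnegrE// prodH_norm_sqr expr2 {1}mulr_suml.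
apply: ler_sum => i _; rewrite inner_norm expr2 ler_wpM2l//.
by rewrite (bigD1 i)//= lerDl; apply: sumr_ge0.
Qed.

Let prodH_norm0_eq0 x : prodH_norm x = 0 -> x = 0.
Proof.
move=> x0; apply/ffunP => i; rewrite ffunE; apply/normr0_eq0/le_anti.
by rewrite normr_ge0 -x0 component_le.
Qed.

Let prodH_normZ a x : prodH_norm (a *: x) = `|a| * prodH_norm x.
Proof.
rewrite /prodH_norm prodH_innerZl prodH_innerC prodH_innerZl mulrA -expr2.
by rewrite sqrtrM ?sqr_ge0// sqrtr_sqr.
Qed.

Let cauchy_schwarz x y : prodH_inner x y <= prodH_norm x * prodH_norm y.
Proof.
have [/prodH_norm0_eq0 ->|x0] := eqVneq (prodH_norm x) 0.
  by rewrite prodH_inner0l mulr_ge0.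
have [/prodH_norm0_eq0 ->|y0] := eqVneq (prodH_norm y) 0.
  by rewrite prodH_innerC prodH_inner0l mulr_ge0.
set a := prodH_norm x; set b := prodH_norm y.
have a0 : 0 < a by rewrite lt_def x0 prodH_norm_ge0.
have b0 : 0 < b by rewrite lt_def y0 prodH_norm_ge0.
have := prodH_innerxx_ge0 (b *: x + (- a) *: y).
rewrite prodH_innerDl !(prodH_innerC _ (_ + _)) !prodH_innerDl.
rewrite !(prodH_innerZl, prodH_innerC _ (_ *: _)) (prodH_innerC y x).
rewrite -!prodH_norm_sqr -/a -/b.
set c := prodH_inner x y; rewrite (_ : _ + _ = (2 * a * b) * (a * b - c)).
  by rewrite pmulr_rge0 ?mulr_gt0// subr_ge0.
by ring.
Qed.

Let prodH_normD x y : prodH_norm (x + y) <= prodH_norm x + prodH_norm y.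
Proof.
rewrite -(@ler_pXn2r _ 2) ?nnegrE ?addr_ge0// prodH_norm_sqr sqrrD.
rewrite !prodH_norm_sqr prodH_innerDl !(prodH_innerC _ (_ + _)) !prodH_innerDl.
by rewrite (prodH_innerC y x); have := cauchy_schwarz x y; lra.
Qed.

HB.instance Definition _ :=
  Lmodule_isNormed.Build R XX prodH_normD prodH_normZ prodH_norm0_eq0.

Let prodH_complete (F : set_system XX) : ProperFilter F -> cauchy F -> cvg F.
Proof.
move=> FF /cauchy_ballP F_cauchy.
pose G i : set_system X := (fun x : XX => x i) @ F.
have G_cvg i : cvg (G i).
  apply: cauchy_cvg; apply/cauchy_ballP => e e0; near_simpl.
  apply: filterS (F_cauchy _ e0) => -[x y] /=.
  rewrite -!ball_normE /=; apply: le_lt_trans.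
  by have := component_le (x - y) i; rewrite !ffunE.
pose l : XX := [ffun i => lim (G i)].
apply/cvg_ex; exists l; apply/cvgrPdist_lt => e e0.
have d0 : 0 < e / m.+1%:R by rewrite divr_gt0.
have /filter_forall :
    forall i, \forall x \near F, `|l i - (x : XX) i| < e / m.+1%:R.
  move=> i; rewrite /l ffunE.
  by move/cvgrPdist_lt : (G_cvg i) => /(_ _ d0).
apply: filterS => x lx; apply: (le_lt_trans (prodH_norm_le _)).
apply: (@le_lt_trans _ _ (\sum_(i < m) e / m.+1%:R)).
  by apply: ler_sum => i _; have := lx i; rewrite !ffunE => /ltW.
rewrite sumr_const card_ord -[_ *+ m]mulr_natr mulrAC ltr_pdivrMr//.
by rewrite ltr_pM2l// ltr_nat.
Qed.

HB.instance Definition _ := Uniform_isComplete.Build XX prodH_complete.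

HB.instance Definition _ := CompleteNormedModule_isHilbert.Build R XX
  prodH_innerC prodH_inner_linearl (fun x => esym (prodH_norm_sqr x)).

End prodH_hilbert.

Section convex_analysis.
Context (R : realType) (H : hilbertType R).
Implicit Types (f g : H -> \bar R) (A B C : set H).

Definition eff_dom f : set H := [set x | (f x < +oo)%E].

Definition proper_fun f : Prop := (forall x, (-oo < f x)%E) /\ eff_dom f !=set0.

(* Only meaningful for functions that avoid -oo, since +oo + -oo = -oo. *)
Definition convex_efun f : Prop := forall (x y : H) (t : R), 0 < t < 1 ->
  (f (t *: x + (1 - t) *: y)%R <= t%:E * f x + (1 - t)%:E * f y)%E.

Definition proper_lsc_convex f : Prop :=
  [/\ proper_fun f, lower_semicontinuous f & convex_efun f].

Definition fenchel_conj f (u : H) : \bar R :=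
  ereal_sup (range (fun x => (inner x u)%:E - f x)%E).

Definition indicator_fun C (x : H) : \bar R := if x \in C then 0%E else +oo%E.

Definition infconv f g (x : H) : \bar R :=
  ereal_inf (range (fun u => f u + g (x - u)%R)%E).

Definition infconv_exact_at f g (x : H) : Prop :=
  exists u, infconv f g x = (f u + g (x - u)%R)%E.

Definition coercive f : Prop :=
  forall M : R, exists r : R, forall x, r < `|x| -> (M%:E < f x)%E.

Definition minkowski_diff A B : set H := [set a - b | a in A & b in B].

Definition conical_hull C : set H :=
  [set l *: c | l in [set l : R | 0 < l] & c in C].

Definition closed_subspace C : Prop := closed C /\ submod_closed (mem C).

Definition orthocomplement C : set H :=
  [set u | forall x, C x -> inner x u = 0].

Definition affine_set C : Prop :=
  forall (x y : H) (t : R), C x -> C y -> C (t *: x + (1 - t) *: y).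

Definition affine_hull C : set H := smallest affine_set C.

Definition relative_interior C : set H :=
  [set x | C x /\ \forall y \near within (affine_hull C) (nbhs x), C y].

Definition finite_dimensional : Prop := exists n, inhabited (Vector.axiom n H).

End convex_analysis.

Arguments finite_dimensional {R} H.

Section product.
Context (R : realType) (X : hilbertType R) (m : nat).

Definition diag_space : set (prodH X m) :=
  range (fun x : X => [ffun=> x] : prodH X m).

Definition direct_sum (g : 'I_m -> X -> \bar R) (x : prodH X m) : \bar R :=
  (\sum_(i < m) g i (x i))%E.

Definition set_prod (C : 'I_m -> set X) : set (prodH X m) :=
  [set x | forall i, C i (x i)].

End product.

Arguments diag_space {R} X m.

(* Main.v *)
Require Import Defs.
From HB Require Import structures.
From mathcomp Require Import all_boot all_order all_algebra.
From mathcomp Require Import all_classical all_reals all_analysis.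
From mathcomp Require Import ring lra.

Set Implicit Arguments.
Unset Strict Implicit.
Unset Printing Implicit Defensive.

Import Order.TTheory GRing.Theory Num.Theory.
Import numFieldNormedType.Exports.

Local Open Scope classical_set_scope.
Local Open Scope ring_scope.

(** Write F for the direct sum of the f_i, D for the diagonal, and F* for the
    conjugate of F, whose domain is the product of the domains of the f_i*.
    The infimal convolution of F with the indicator of D is
    h(x) = inf of F over x + D, so that D is all that matters of the product
    structure, and the core is a statement about a closed subspace D of a
    Hilbert space: if Y = cone (dom F* - D^perp) is a closed subspace, then h is
    proper, lower semicontinuous and convex, and every infimum is attained
    (attouch_brezis).

    Both lower semicontinuity and attainment say that approximate minimizers
    can be replaced by a minimizer: if for every e > 0 some z lies in x' + D
    with |x' - x| <= e and F z <= c + e, then some z in x + D has F z <= c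
    (approximate_minimizers_limit). The approximate minimizers may be unbounded
    in directions where F does not grow. However D^perp is contained in Y, hence
    Y^perp in D, and F is invariant under translations by Y^perp because F is the supremum of
    its affine minorants, whose slopes lie in Y (Fenchel-Moreau). Projecting
    onto x + Y, one may thus assume that z - x is in Y. For a in dom F* and w in
    D^perp, the Fenchel-Young inequality bounds <z, a> above while <z - x, w>
    is small, so every functional <., y> with y in Y is bounded above on the
    vectors z - x; by the uniform boundedness principle these are bounded
    in norm. The approximate minimizers at level e form closed, convex, bounded
    sets that decrease with e, and such sets have a common point
    (nested_closed_convex).

    The Fenchel-Moreau theorem is obtained from the proximal points of F, which
    are again minimizers produced by nested_closed_convex: the proximal point q
    of p with parameter k carries the affine minorant of slope k (p - q), and
    q tends to p as k grows.

    It remains to see that each of the five hypotheses makes Y a closed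
    subspace. For (i) this is the hypothesis, and for (iii) and (iv) the set
    dom F* - D^perp contains a ball around 0. For (v), a point of the relative
    interior allows every segment of the convex set to be prolonged beyond
    it, so the cone is stable under negation (relative_interior_cone), and
    subspaces are closed in finite dimension. For (ii), a coercive convex
    function grows at least linearly: F >= e |.| - B on D
    (coercive_linear_growth). The core statement applied to F* and D^perp shows
    that k = inf-convolution of F* and the indicator of D^perp is its own
    biconjugate; since k* = F + indicator of D, the growth of F makes k finite
    on the ball of radius e, which says that this ball lies in dom F* - D^perp
    (coercive_qualification). *)

(** * Hilbert space geometry *)

Section inner_product.
Context (R : realType) (H : hilbertType R).
Implicit Types (x y z : H) (a c : R).

Lemma innerDl x y z : inner (x + y) z = inner x z + inner y z.
Proof. by rewrite linearDl. Qed.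

Lemma innerNl x z : inner (- x) z = - inner x z.
Proof. by rewrite linearNl. Qed.

Lemma innerZl a x z : inner (a *: x) z = a * inner x z.
Proof. by rewrite linearZl_LR. Qed.

Lemma inner0l z : inner 0 z = 0.
Proof. by rewrite linear0l. Qed.

Lemma innerDr x y z : inner z (x + y) = inner z x + inner z y.
Proof. by rewrite linearDr. Qed.

Lemma innerNr x z : inner z (- x) = - inner z x.
Proof. by rewrite linearNr. Qed.

Lemma innerZr a x z : inner z (a *: x) = a * inner z x.
Proof. by rewrite linearZr_LR. Qed.

Lemma inner0r z : inner z 0 = 0.
Proof. by rewrite linear0r. Qed.

Definition inner_lin := (innerDl, innerDr, innerNl, innerNr, innerZl, innerZr).

Lemma inner_sumr (I : finType) (F : I -> H) z :
  inner z (\sum_i F i) = \sum_i inner z (F i).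
Proof.
by elim/big_ind2: _ => [|? ? ? ? <- <-|//]; rewrite ?inner0r// innerDr.
Qed.

Lemma inner_suml (I : finType) (F : I -> H) z :
  inner (\sum_i F i) z = \sum_i inner (F i) z.
Proof. by rewrite innerC inner_sumr; apply: eq_bigr => i _; exact: innerC. Qed.

Lemma inner_eq0 x : inner x x = 0 -> x = 0.
Proof. by rewrite inner_norm => /eqP; rewrite sqrf_eq0 normr_eq0 => /eqP. Qed.

Lemma normD_sqr x y : `|x + y| ^+ 2 = `|x| ^+ 2 + 2 * inner x y + `|y| ^+ 2.
Proof. by rewrite -!inner_norm !inner_lin (innerC y x); ring. Qed.

Lemma normB_sqr x y : `|x - y| ^+ 2 = `|x| ^+ 2 - 2 * inner x y + `|y| ^+ 2.
Proof. by rewrite normD_sqr innerNr normrN; ring. Qed.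

Lemma parallelogram x y :
  `|x - y| ^+ 2 = 2 * `|x| ^+ 2 + 2 * `|y| ^+ 2 - `|x + y| ^+ 2.
Proof. by rewrite normB_sqr normD_sqr; ring. Qed.

(** Cauchy-Schwarz, read off from the sign of the square of the norm of
    |y| x - |x| y. *)
Lemma inner_le_norm x y : inner x y <= `|x| * `|y|.
Proof.
have [->|x0] := eqVneq x 0; first by rewrite inner0l normr0 mul0r.
have [->|y0] := eqVneq y 0; first by rewrite inner0r normr0 mulr0.
have := sqr_ge0 `|(`|y| *: x - `|x| *: y)|.
rewrite normB_sqr !normrZ !normr_id !inner_lin.
rewrite (_ : _ + _ = (2 * (`|x| * `|y|)) * (`|x| * `|y| - inner x y)); last by ring.
by rewrite pmulr_rge0 ?mulr_gt0 ?normr_gt0// subr_ge0.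
Qed.

Lemma norm_inner_le x y : `|inner x y| <= `|x| * `|y|.
Proof.
by rewrite ler_norml inner_le_norm andbT lerNl -innerNl -(normrN x) inner_le_norm.
Qed.

Lemma inner_continuous z : continuous (fun x => inner x z).
Proof.
move=> x; apply/cvgrPdist_lt => e e0.
have d0 : 0 < e / (`|z| + 1) by rewrite divr_gt0// ltr_wpDl.
near=> y; rewrite -innerNl -innerDl.
apply: (le_lt_trans (norm_inner_le _ _)).
apply: (@le_lt_trans _ _ (`|x - y| * (`|z| + 1))).
  by rewrite ler_wpM2l// lerDl.
rewrite -ltr_pdivlMr; last by rewrite ltr_wpDl.
near: y; apply/nbhs_ballP; exists (e / (`|z| + 1)) => // y;
  by rewrite -ball_normE.
Unshelve. all: by end_near. Qed.

Lemma closed_halfspace z c : closed [set x | inner x z <= c].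
Proof.
rewrite (_ : mkset _ = (fun x => inner x z) @^-1` [set r | r <= c])//.
by apply: (proj1 (continuous_closedP _) (@inner_continuous z)); exact: closed_le.
Qed.

Lemma closed_shift (C : set H) p : closed C -> closed [set x | C (x - p)].
Proof.
move=> Cc; rewrite (_ : mkset _ = (fun x => x - p) @^-1` C)//.
apply: (proj1 (continuous_closedP _) _) => // x.
by apply: cvgB; [exact: cvg_id|exact: cvg_cst].
Qed.

Definition convex_set (C : set H) := forall x y a, 0 < a < 1 ->
  C x -> C y -> C (a *: x + (1 - a) *: y).

(** A substitute for weak compactness. Nearly minimal-norm points z_n of C_n
    form a Cauchy sequence: for n <= p the midpoint of z_n and z_p is in C_n, so
    the parallelogram law bounds |z_n - z_p| by the growth of the squared
    distances d_n from 0 to C_n, which are nondecreasing and bounded. The norm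
    of the limit is minimal; for a constant sequence C this gives the projection
    of 0 onto C. *)
Lemma nested_closed_convex (C : nat -> set H) (M : R) :
  (forall n, closed (C n)) -> (forall n, convex_set (C n)) ->
  (forall n p, (n <= p)%N -> C p `<=` C n) ->
  (forall n, exists2 x, C n x & `|x| <= M) ->
  exists2 x, (forall n, C n x) & forall y, (forall n, C n y) -> `|x| <= `|y|.
Proof.
move=> Ccl Ccv Cdec Cne.
pose E n := [set `|x| ^+ 2 | x in C n].
pose d n := inf (E n).
have M0 : 0 <= M by have [x _] := Cne 0%N; exact: le_trans.
have Einf n : has_inf (E n).
  split; first by have [x Cx _] := Cne n; exists (`|x| ^+ 2), x.
  by exists 0 => _ [x _ <-]; exact: sqr_ge0.
have dle n x : C n x -> d n <= `|x| ^+ 2.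
  by move=> Cx; apply: ge_inf; [exact: (Einf n).2|exists x].
have dM n : d n <= M ^+ 2.
  have [x Cx xM] := Cne n; apply: le_trans (dle _ _ Cx) _.
  by rewrite ler_sqr ?nnegrE.
have dmono n p : (n <= p)%N -> d n <= d p.
  move=> np; apply: lb_le_inf; first exact: (Einf p).1.
  by move=> _ [x Cx <-]; apply: dle; exact: Cdec Cx.
pose e n : R := n.+1%:R^-1.
have e0 n : 0 < e n by rewrite invr_gt0.
have z_ n : {x | C n x /\ `|x| ^+ 2 < d n + e n}.
  by apply: cid; have [_ [x Cx <-] xd] := inf_adherent (e0 n) (Einf n); exists x.
pose z n := proj1_sig (z_ n).
have Cz n : C n (z n) by rewrite /z; case: (z_ n) => x [].
have zd n : `|z n| ^+ 2 < d n + e n by rewrite /z; case: (z_ n) => x [].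
have zdist n p : (n <= p)%N ->
    `|z n - z p| ^+ 2 <= 2 * (d p - d n) + 4 * e n.
  move=> np; have h2 : 0 < (2^-1 : R) < 1 by apply/andP; split; lra.
  have := dle n _ (Ccv n _ _ _ h2 (Cz n) (Cdec _ _ np _ (Cz p))).
  rewrite (_ : 1 - 2^-1 = 2^-1); last by lra.
  rewrite -scalerDr normrZ exprMn ger0_norm ?invr_ge0// => h.
  have ep : e p <= e n by rewrite lef_pV2 ?posrE// ler_nat.
  have := zd n; have := zd p; rewrite parallelogram => zdp zdn.
  by lra.
pose D := sup (range d).
have Dsup : has_sup (range d).
  by split; [exists (d 0%N), 0%N|exists (M ^+ 2) => _ [n _ <-]].
have dD n : d n <= D by apply: ub_le_sup; [exact: Dsup.2|exists n].
have zcauchy : cauchy (z @ \oo).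
  apply/cauchy_ballP => r r0; rewrite near_simpl.
  pose t := r ^+ 2 / 64.
  have t0 : 0 < t by rewrite divr_gt0 ?exprn_gt0.
  have [_ [N _ <-]] := sup_adherent t0 Dsup; rewrite -/D => DN.
  have [K _ eK] : \forall n \near \oo, e n < t.
    exact: (near_infty_natSinv_lt (PosNum t0)).
  pose N' := maxn N K.
  have close n : (N' <= n)%N -> `|z N' - z n| < r / 2.
    move=> Nn; rewrite -ltr_sqr ?nnegrE; [|by []|by rewrite divr_ge0// ltW].
    apply: (le_lt_trans (zdist _ _ Nn)).
    have h1 := dD n; have h2 : d N <= d N' by apply: dmono; rewrite leq_maxl.
    have h3 : e N' < t by apply: eK; rewrite /= leq_maxr.
    have : D - d N < t by lra.
    rewrite /t exprMn exprVn => h4; have : 0 < r ^+ 2 by rewrite exprn_gt0.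
    by rewrite /t in h3 *; lra.
  exists ([set n | N' <= n]%N, [set n | N' <= n]%N).
    by split; exists N'.
  case=> n p /= [Nn Np]; rewrite -ball_normE /=.
  rewrite (_ : z n - z p = (z N' - z p) - (z N' - z n)); last first.
    by rewrite opprB [RHS]addrC addrA subrK.
  apply: (le_lt_trans (ler_normB _ _)).
  by have := close _ Nn; have := close _ Np; lra.
have zcvg : cvg (z @ \oo) by apply: cauchy_cvg.
pose x : H := lim (z @ \oo).
have zx : z @ \oo --> x by exact: zcvg.
exists x.
  move=> n; apply: (closed_cvg _ (Ccl n) _ _ zx).
  by exists n => // p np; exact: Cdec (Cz p).
move=> y Cy; have yD : D <= `|y| ^+ 2.
  by apply: ge_sup; [exact: Dsup.1|move=> _ [n _ <-]; exact: dle].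
rewrite -ler_sqr ?nnegrE//; apply: le_trans yD.
apply/ler_addgt0Pr => r r0.
have zx2 : (fun n => `|z n| ^+ 2) @ \oo --> `|x| ^+ 2.
  by apply: (continuous_cvg _ (@exprn_continuous _ 2 _)); exact: cvg_norm.
apply: (closed_cvg _ (@closed_le _ (D + r)) _ _ zx2).
have [K _ eK] : \forall n \near \oo, e n < r.
  exact: (near_infty_natSinv_lt (PosNum r0)).
exists K => // n Kn /=; have := zd n; have := dD n; have := eK _ Kn.
by rewrite /=; lra.
Qed.

End inner_product.

(** * Orthogonal projection and uniform boundedness *)

Section subspaces.
Context (R : realType) (H : hilbertType R).
Implicit Types (C D Y : set H) (x y z u : H).

Lemma submodP C : submod_closed (mem C) <->
  C 0 /\ forall a x y, C x -> C y -> C (a *: x + y).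
Proof.
split=> [[C0 CL]|[C0 CL]]; split.
- by move: C0; rewrite inE.
- move=> a x y Cx Cy; have := CL a x y; rewrite !inE; exact.
- by rewrite inE.
- by move=> a x y; rewrite !inE; exact: CL.
Qed.

Lemma orthocomplement_closed_subspace C : closed_subspace (orthocomplement C).
Proof.
split; last first.
  apply/submodP; split=> [x _|a x y xC yC z Cz]; first by rewrite inner0r.
  by rewrite !inner_lin xC// yC// mulr0 addr0.
rewrite (_ : orthocomplement C = \bigcap_(x in C) [set u | inner u x <= 0] `&`
                     \bigcap_(x in C) [set u | inner u (- x) <= 0]).
  by apply: closedI; apply: closed_bigI => x _; exact: closed_halfspace.
apply/seteqP; split=> [u uC|u [u1 u2] x Cx].
  by split=> x Cx /=; rewrite ?innerNr innerC uC// oppr0.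
have := u1 _ Cx; have := u2 _ Cx; rewrite /= innerNr (innerC u x) oppr_le0 => ? ?.
by apply/le_anti/andP.
Qed.

(** x - p is the element of least norm in x + Y; comparing it with its
    translates by multiples of y in Y gives orthogonality. *)
Lemma projection Y : closed_subspace Y ->
  forall x, exists2 p, Y p & orthocomplement Y (x - p).
Proof.
move=> [Ycl /submodP[Y0 YL]] x.
have [||||v vY vmin] := @nested_closed_convex _ _
    (fun=> [set v | Y (v - x)]) `|x|.
- by move=> _; exact: closed_shift.
- move=> _ v w a _ /= Yv Yw.
  rewrite (_ : _ - x = a *: (v - x) + ((1 - a) *: (w - x) + 0)); last first.
    rewrite addr0 !scalerBr addrACA -opprD -scalerDl.
    by rewrite (_ : a + (1 - a) = 1) ?scale1r//; lra.
  by apply: (YL) => //; exact: (YL).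
- by move=> n p _ v.
- by move=> _; exists x => //=; rewrite subrr.
have {}vY := vY 0%N.
have YN y : Y y -> Y (- y) by move=> Yy; have := YL (-1) _ _ Yy Y0; rewrite scaleN1r addr0.
exists (x - v); first by rewrite -opprB; exact: YN.
rewrite subKr => y Yy; rewrite innerC.
(* t is nearly optimal; the added 1 avoids a separate case y = 0. *)
pose t := - inner v y / (`|y| ^+ 2 + 1).
have q0 : 0 <= `|y| ^+ 2 by rewrite sqr_ge0.
have /vmin : nat -> Y (v + t *: y - x) by rewrite addrAC addrC => _; exact: YL.
rewrite -ler_sqr ?nnegrE// normD_sqr innerZr normrZ exprMn real_normK ?num_real//.
set s := inner v y in t *; set q := `|y| ^+ 2 in q0 t *.
rewrite -addrA lerDl /t => h.
apply/eqP; rewrite -sqrf_eq0; apply/eqP/le_anti; rewrite sqr_ge0 andbT.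
have q1 : 0 < q + 1 by lra.
move: h; rewrite (_ : _ + _ = - (s ^+ 2 * (q + 2)) / (q + 1) ^+ 2); last first.
  by field; lra.
rewrite pmulr_lge0 ?invr_gt0 ?exprn_gt0// oppr_ge0 pmulr_lle0//; lra.
Qed.

Lemma orthocomplementK D : closed_subspace D ->
  orthocomplement (orthocomplement D) = D.
Proof.
move=> Dcs; apply/seteqP; split=> [x xD|x Dx u uD]; last by rewrite innerC uD.
have [p Dp px] := projection Dcs x.
suff /inner_eq0/subr0_eq -> : inner (x - p) (x - p) = 0 by [].
by rewrite innerDr innerNr xD// innerC px// subr0.
Qed.

(** Banach-Steinhaus for the functionals <z, .>. One-sided bounds suffice
    because y and - y are both allowed. *)
Lemma weakly_bounded (S : set H) :
  (forall y, exists c, forall z, S z -> inner z y <= c) ->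
  exists M, forall z, S z -> `|z| <= M.
Proof.
move=> Sb.
have [||M SM] := @Banach_Steinhauss R H R^o [set (fun y => inner z y) | z in S] _ _ 1.
- move=> _ [z _ <-]; split; last by move=> a x y; rewrite innerDr innerZr.
  move=> r; exists (`|z| * r) => x xr; apply: (le_trans (norm_inner_le _ _)).
  by rewrite ler_wpM2l.
- move=> y; have [c1 h1] := Sb y; have [c2 h2] := Sb (- y).
  exists (`|c1| + `|c2|) => _ [z Sz <-].
  have := h1 _ Sz; have := h2 _ Sz; rewrite innerNr => ? ?.
  have := ler_norm c1; have := ler_norm c2; have := normr_ge0 c1; have := normr_ge0 c2.
  by rewrite ler_norml => ? ? ? ?; apply/andP; split; lra.
exists M => z Sz; have [->|z0] := eqVneq z 0.
  rewrite normr0; have := SM _ (imageP _ Sz) 0; rewrite normr0 inner0r normr0.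
  by apply.
have := SM _ (imageP _ Sz) (`|z|^-1 *: z).
rewrite normrZ normfV normr_id mulVf ?normr_eq0// => /(_ (lexx _)).
rewrite innerZr inner_norm expr2 mulrA mulVf ?normr_eq0// mul1r.
by rewrite normr_id.
Qed.

End subspaces.

(** * Conjugates, affine minorants and the Fenchel-Moreau theorem *)

Section fenchel.
Context (R : realType) (H : hilbertType R).
Implicit Types (F : H -> \bar R) (x y p q u v : H) (a b c k t : R).
Local Notation "F ^*" := (fenchel_conj F).

Lemma le0_of_le_small (a b : R) : (forall t, 0 < t < 1 -> a <= t * b) -> a <= 0.
Proof.
move=> h; rewrite leNgt; apply/negP => a0.
have b1 : 0 < `|b| + 1 by rewrite ltr_wpDl.
pose t := Num.min 2^-1 (a / (2 * (`|b| + 1))).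
have t0 : 0 < t by rewrite lt_min invr_gt0 divr_gt0 ?mulr_gt0 ?andbT.
have t1 : t < 1 by rewrite gt_min; apply/orP; left; lra.
have := h t; rewrite t0 t1 => /(_ isT).
have : t * b <= a / (2 * (`|b| + 1)) * (`|b| + 1).
  apply: (@le_trans _ _ (t * (`|b| + 1))).
    by rewrite ler_pM2l//; have := ler_norm b; lra.
  by rewrite ler_pM2r// ge_min lexx orbT.
rewrite (_ : _ / _ * _ = a / 2); first by lra.
by field; lra.
Qed.

(** The free parameter e serves two purposes: e = 1 gives boundedness of s, and
    a small e with a large k makes s small. *)
Lemma quadratic_bound (e k s A B : R) : 0 < e -> 0 < k -> 0 <= s ->
  k * s ^+ 2 <= A + B * s -> s <= e + (`|A| / e + `|B|) / k.
Proof.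
move=> e0 k0 s0 h.
have N0 : 0 <= (`|A| / e + `|B|) / k.
  by rewrite divr_ge0 ?addr_ge0 ?divr_ge0// ltW.
have [se|es] := leP s e; first by lra.
have s1 : 0 < s by lra.
apply: ler_wpDl; first exact: ltW.
rewrite ler_pdivlMr// -(ler_pM2r s1) mulrDl.
rewrite (_ : s * k * s = k * s ^+ 2); last by ring.
apply: (le_trans h); apply: lerD; last by rewrite ler_pM2r// ler_norm.
rewrite mulrAC -mulrA; apply: (le_trans (ler_norm A)).
by rewrite ler_peMr// ler_pdivlMr// mul1r ltW.
Qed.

(** Conjugates are handled only through their real upper bounds, which are the
    affine minorants of F: this replaces extended-real suprema by real
    inequalities. *)
Lemma conj_leP F u b :
  (F^* u <= b%:E)%E <-> forall x, ((inner x u - b)%:E <= F x)%E.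
Proof.
have E x : ((inner x u)%:E - F x <= b%:E)%E = ((inner x u - b)%:E <= F x)%E.
  case: (F x) => [r| |] //=; rewrite ?leNye ?leey//.
  by rewrite -EFinB !lee_fin; lra.
split=> [h x|h].
  rewrite -E; apply: le_trans h; apply: ereal_sup_ubound; by exists x.
by apply: ge_ereal_sup => _ [x _ <-]; rewrite E.
Qed.

Lemma dom_real (G : H -> \bar R) x : eff_dom G x -> exists b, (G x <= b%:E)%E.
Proof.
by rewrite /eff_dom /=; case: (G x) => [r _|//|_]; [exists r|exists 0; rewrite leNye].
Qed.

Lemma le_dom (G : H -> \bar R) x b : (G x <= b%:E)%E -> eff_dom G x.
Proof. by move=> h; apply: le_lt_trans h _; rewrite ltry. Qed.

Lemma le_real (x y : \bar R) : (forall c, (y <= c%:E)%E -> (x <= c%:E)%E) -> (x <= y)%E.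
Proof.
case: y => [r|_|h]; [exact|exact: leey|].
case: x h => [r|/(_ 0)|//] h; last by apply: h; rewrite leNye.
by have := h (r - 1) (leNye _); rewrite lee_fin => ?; exfalso; lra.
Qed.

Lemma convex_efunP F : (forall x, (-oo < F x)%E) ->
  convex_efun F <-> forall x y t a b, 0 < t < 1 ->
    (F x <= a%:E)%E -> (F y <= b%:E)%E ->
    (F (t *: x + (1 - t) *: y)%R <= (t * a + (1 - t) * b)%:E)%E.
Proof.
move=> FNy; split=> [Fc x y t a b t01 xa yb|h x y t t01].
  have /andP[t0 t1] := t01.
  apply: le_trans (Fc x y t t01) _; rewrite (EFinD (t * a)) !EFinM leeD//.
    by rewrite lee_pmul2l.
  by rewrite lee_pmul2l// lte_fin subr_gt0.
have /andP[t0 t1] := t01; have t1' : 0 < 1 - t by rewrite subr_gt0.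
have := FNy x; have := FNy y; case Fx : (F x) => [a| |] //; last first.
  move=> yNy _; rewrite gt0_muley ?lte_fin// addye ?leey//.
  by case: (F y) yNy => [r| |]//; rewrite gt0_muley ?lte_fin.
case Fy : (F y) => [b| |] // _ _.
  by rewrite -!EFinM -EFinD; apply: h; rewrite ?Fx ?Fy.
by rewrite (gt0_muley (x := (1 - t)%:E)) ?lte_fin// addey ?leey.
Qed.

Lemma closed_sublevel F (g : H -> R) : lower_semicontinuous F -> continuous g ->
  closed [set v | (F v <= (g v)%:E)%E].
Proof.
move=> Flsc gc; rewrite -[X in closed X]setCK closedC openE => v /= /negP.
rewrite -ltNge => gF.
have [a ga aF] : exists2 a, g v < a & (a%:E < F v)%E.
  move: gF; case: (F v) => [r|_|//]; last by exists (g v + 1); rewrite ?ltry//; lra.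
  by rewrite lte_fin => gr; exists ((g v + r) / 2); rewrite ?lte_fin; lra.
have [V Vv VF] := Flsc _ _ aF.
have ga' : \forall w \near v, g w < a by exact: (gc v _ (@lt_nbhsl _ _ _ ga)).
rewrite /interior; near=> w; apply/negP; rewrite -ltNge.
apply: (@lt_trans _ _ a%:E); first by rewrite lte_fin; near: w.
by apply: VF; near: w.
Unshelve. all: by end_near. Qed.

End fenchel.

Section biconjugate.
Context (R : realType) (H : hilbertType R).
Implicit Types (F : H -> \bar R) (x y p q u v : H) (a b c k t : R).

Definition is_minorant F u b := forall x, ((inner x u - b)%:E <= F x)%E.

Lemma norm_sqr_conv x y t :
  `|t *: x + (1 - t) *: y| ^+ 2 =
  t * `|x| ^+ 2 + (1 - t) * `|y| ^+ 2 - t * (1 - t) * `|x - y| ^+ 2.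
Proof.
by rewrite -!inner_norm !inner_lin (innerC y x); ring.
Qed.

Lemma conv_shift x y p t :
  t *: x + (1 - t) *: y - p = t *: (x - p) + (1 - t) *: (y - p).
Proof.
rewrite !scalerBr addrACA -opprD -scalerDl.
by rewrite (_ : t + (1 - t) = 1) ?scale1r//; ring.
Qed.

(** q is the proximal point of p, the minimizer of F + k/2 |. - p|^2. It exists
    by nested_closed_convex since the given minorant makes the sublevel sets
    bounded; the minorant of slope k (p - q) is the first-order optimality
    condition. *)
Lemma proximal_minorant F u0 b0 p k : proper_lsc_convex F ->
  is_minorant F u0 b0 -> 0 < k ->
  exists q r, F q = r%:E /\ is_minorant F (k *: (p - q)) (inner q (k *: (p - q)) - r).
Proof.
move=> [[FNy [x0 x0F]] Flsc /(convex_efunP FNy) Fcv] Fmin k0.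
pose Q v := k / 2 * `|v - p| ^+ 2.
have k2 : 0 < k / 2 by rewrite divr_gt0.
have Qc : continuous Q.
  move=> v; apply: cvgM; first exact: cvg_cst.
  apply: (continuous_cvg _ (@exprn_continuous _ 2 _)); apply: cvg_norm.
  by apply: cvgB; [exact: cvg_id|exact: cvg_cst].
have growth v c : (F v <= (c - Q v)%:E)%E ->
    k / 2 * `|v - p| ^+ 2 <= c + b0 - inner p u0 + `|u0| * `|v - p|.
  move=> /(le_trans (Fmin v)); rewrite lee_fin /Q => h.
  have := inner_le_norm (p - v) u0; rewrite innerDl innerNl distrC mulrC.
  by lra.
pose E := [set c | exists v, (F v <= (c - Q v)%:E)%E].
have Einf : has_inf E.
  split.
    have [b xb] := dom_real x0F; exists (b + Q x0), x0.
    by rewrite addrK.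
  exists (inner p u0 - b0 - `|u0| ^+ 2 / (2 * k)) => c [v /growth h].
  have := sqr_ge0 (k * `|v - p| - `|u0|) => sq.
  have : 0 <= (k * `|v - p| - `|u0|) ^+ 2 / (2 * k).
    by rewrite divr_ge0// mulr_ge0// ltW.
  rewrite (_ : _ / _ = k / 2 * `|v - p| ^+ 2 - `|u0| * `|v - p| + `|u0| ^+ 2 / (2 * k)); last first.
    by field; lra.
  by lra.
pose mu := inf E.
pose e n : R := n.+1%:R^-1.
have e0 n : 0 < e n by rewrite invr_gt0.
have [||||q qS _] := @nested_closed_convex _ _
   (fun n => [set v | (F v <= (mu + e n - Q v)%:E)%E])
   (`|p| + (1 + (`|mu + 1 + b0 - inner p u0| / 1 + `| `|u0| |) / (k / 2))).
- move=> n; apply: closed_sublevel => // v.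
  by apply: cvgB; [exact: cvg_cst|exact: Qc].
- move=> n v w t t01 /= Fv Fw; apply: le_trans (Fcv _ _ _ _ _ t01 Fv Fw) _.
  rewrite lee_fin /Q conv_shift norm_sqr_conv.
  have /andP[t0 t1] := t01.
  have : 0 <= k / 2 * (t * (1 - t) * `|v - p - (w - p)| ^+ 2).
    by rewrite !mulr_ge0 ?sqr_ge0// ltW// subr_gt0.
  by lra.
- move=> n m nm v /= h; apply: le_trans h _; rewrite lee_fin lerD2r lerD2l.
  by rewrite lef_pV2 ?posrE// ler_nat.
- move=> n; have [c [v vc] cE] := inf_adherent (e0 n) Einf.
  have vn : (F v <= (mu + e n - Q v)%:E)%E.
    by apply: le_trans vc _; rewrite lee_fin lerD2r ltW.
  exists v => //.
  have e1 : e n <= 1 by rewrite invf_le1// ler1n.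
  have := growth _ _ vn => h.
  have {}h : k / 2 * `|v - p| ^+ 2 <= mu + 1 + b0 - inner p u0 + `|u0| * `|v - p| by lra.
  have := quadratic_bound (ltr01 : 0 < 1 :> R) k2 (normr_ge0 _) h.
  have := ler_normD (v - p) p; rewrite subrK.
  by lra.
have [r Er] : exists r, F q = r%:E.
  by move: (FNy q) (qS 0%N) => /=; case: (F q) => [r| |]//; exists r.
have Fq : r <= mu - Q q.
  apply/ler_addgt0Pr => d d0.
  have [n _ /(_ n (leqnn n)) /= en] := near_infty_natSinv_lt (PosNum d0).
  have := qS n; rewrite /= Er lee_fin => /le_trans; apply.
  by rewrite addrAC lerD2l ltW.
exists q, r; split => // v.
have [s Es] : exists s, F v = s%:E \/ F v = +oo%E.
  by move: (FNy v); case: (F v) => [s|_|]//; [exists s; left|exists 0; right].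
case: Es => Es; rewrite Es ?leey// lee_fin.
rewrite (_ : _ - _ = r + k * inner (v - q) (p - q)); last first.
  by rewrite !inner_lin; ring.
(* Compare q with the points t v + (1 - t) q and let t tend to 0. *)
rewrite -subr_le0.
apply: (@le0_of_le_small _ _ (k / 2 * `|v - q| ^+ 2)) => t t01.
have /andP[t0 t1] := t01.
have Fvs : (F v <= s%:E)%E by rewrite Es.
have Fqr : (F q <= r%:E)%E by rewrite Er.
have FF := Fcv _ _ _ _ _ t01 Fvs Fqr.
have /(ge_inf Einf.2) : E (t * s + (1 - t) * r + Q (t *: v + (1 - t) *: q)).
  by exists (t *: v + (1 - t) *: q); rewrite addrK.
rewrite -/mu; move: Fq; rewrite /Q.
rewrite (_ : _ + _ - p = (q - p) + t *: (v - q)); last first.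
  by rewrite scalerBl scale1r scalerBr addrCA addrAC.
rewrite (normD_sqr (q - p)) innerZr normrZ exprMn real_normK ?num_real// => h1 h2.
rewrite -(ler_pM2l t0).
rewrite innerC -(opprB q p) innerNl.
by lra.
Qed.

(** A bound at p on all affine minorants bounds F at the proximal points q of
    p, and forces k |p - q|^2 to grow at most linearly in |p - q|. Hence q tends
    to p as k grows, and lower semicontinuity carries the bound to p. *)
Lemma fenchel_moreau F u0 b0 p c : proper_lsc_convex F -> is_minorant F u0 b0 ->
  (forall u b, is_minorant F u b -> inner p u - b <= c) -> (F p <= c%:E)%E.
Proof.
move=> Fplc Fmin h; rewrite leNgt; apply/negP => cF.
have [_ Flsc _] := Fplc.
have [V /nbhs_ballP[d /= d0 dV] VF] := Flsc _ _ cF.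
pose A := c + b0 - inner p u0.
have d2 : 0 < d / 2 by rewrite divr_gt0.
(* k is chosen so that quadratic_bound puts q in the ball of radius d. *)
pose T : R := `|A| / (d / 2) + `| `|u0| |.
have T0 : 0 <= T by rewrite addr_ge0// divr_ge0// ltW.
pose k : R := (T + 1) / (d / 2).
have k0 : 0 < k by rewrite divr_gt0// ltr_wpDl.
have [q [r [Fq qmin]]] := proximal_minorant p Fplc Fmin k0.
have := h _ _ qmin; rewrite opprB addrCA -innerNl -innerDl innerZr inner_norm => hr.
have := Fmin q; rewrite Fq lee_fin => h0.
have hs : k * `|p - q| ^+ 2 <= A + `|u0| * `|p - q|.
  by have := inner_le_norm (p - q) u0; rewrite innerDl innerNl mulrC /A; lra.
have := quadratic_bound d2 k0 (normr_ge0 _) hs; rewrite -/T => ps.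
have Tk : T / k < d / 2.
  by rewrite ltr_pdivrMr// /k mulrC divfK ?gt_eqF//; lra.
have /VF : V q by apply: dV; rewrite -ball_normE /=; lra.
rewrite Fq lte_fin => cr.
have : 0 <= k * `|p - q| ^+ 2 by rewrite mulr_ge0 ?sqr_ge0// ltW.
by lra.
Qed.

Local Notation "F ^*" := (fenchel_conj F).

Lemma conj_gtNy F x u : eff_dom F x -> (-oo < F^* u)%E.
Proof.
move=> /dom_real[b xb]; rewrite ltNge leeNy_eq; apply/negP => /eqP uNy.
have /conj_leP/(_ x) : (F^* u <= (inner x u - b - 1)%:E)%E by rewrite uNy leNye.
by move=> /le_trans/(_ xb); rewrite lee_fin; lra.
Qed.

Lemma conj_plc F : proper_fun F -> eff_dom (F^*) !=set0 -> proper_lsc_convex (F^*).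
Proof.
move=> [FNy [x0 x0F]] F0; have FcNy u := conj_gtNy u x0F.
split=> //.
- move=> u a au.
  have [x ax] : exists x, (a%:E < (inner x u)%:E - F x)%E.
    apply: contrapT => /forallNP h.
    suff : (F^* u <= a%:E)%E by rewrite leNgt au.
    by apply: ge_ereal_sup => _ [x _ <-]; rewrite leNgt; apply/negP.
  have [r Fx] : exists r, F x = r%:E.
    by move: (FNy x) ax; case: (F x) => [r| |]//; exists r.
  exists [set v | inner x u - (inner x u - r - a) < inner x v].
    apply: (@cvgr_gt _ _ _ _ (fun v => inner x v) (inner x u)).
      rewrite (_ : (fun v => _) = (fun v => inner v x)); last first.
        by apply/funext => v; exact: innerC.
      by rewrite innerC; exact: inner_continuous.
    by move: ax; rewrite Fx -EFinB lte_fin; lra.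
  move=> v /= h; apply: (@lt_le_trans _ _ ((inner x v)%:E - F x)%E).
    by rewrite Fx -EFinB lte_fin; lra.
  by apply: ereal_sup_ubound; exists x.
- apply/convex_efunP => // u v t a b /andP[t0 t1] /conj_leP ua /conj_leP vb.
  apply/conj_leP => x; rewrite !inner_lin.
  have := ua x; have := vb x; move: (FNy x); case: (F x) => [r| |]//; last by move=> *; rewrite leey.
  rewrite !lee_fin => _ h1 h2.
  have : 0 <= t * (r - (inner x u - a)) by rewrite mulr_ge0; lra.
  have : 0 <= (1 - t) * (r - (inner x v - b)) by rewrite mulr_ge0; lra.
  by lra.
Qed.

Lemma conj_conj F : proper_lsc_convex F -> eff_dom (F^*) !=set0 -> F^*^* = F.
Proof.
move=> Fplc [u0 /dom_real[b0 /conj_leP Fmin]].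
apply/funext => p; apply/le_anti/andP; split; apply: le_real => c h.
  apply/conj_leP => u; apply: le_real => b /conj_leP ub.
  rewrite lee_fin innerC; have := le_trans (ub p) h; rewrite lee_fin; lra.
apply: (fenchel_moreau Fplc Fmin) => u b ub.
have /conj_leP ub' := ub; have /conj_leP/(_ u) := h.
by move=> /le_trans/(_ ub'); rewrite lee_fin innerC; lra.
Qed.

End biconjugate.

(** * Infimal convolution with the indicator of a closed subspace *)

Section attouch_brezis.
Context (R : realType) (H : hilbertType R).
Implicit Types (F : H -> \bar R) (C D Y : set H) (x y z u v w : H).
Local Notation "F ^*" := (fenchel_conj F).
Local Notation perp := orthocomplement.
Local Notation coneD F D := (conical_hull (minkowski_diff (eff_dom (F ^*)) (perp D))).

Lemma subspaceP D : closed_subspace D ->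
  [/\ D 0, forall x y, D x -> D y -> D (x + y), forall x, D x -> D (- x) &
      forall a x, D x -> D (a *: x)].
Proof.
move=> [_ /submodP[D0 DL]].
have DD x y : D x -> D y -> D (x + y).
  by move=> Dx Dy; have := DL 1 _ _ Dx Dy; rewrite scale1r.
have DZ a x : D x -> D (a *: x).
  by move=> Dx; have := DL a _ _ Dx D0; rewrite addr0.
by split=> // x Dx; rewrite -scaleN1r; exact: DZ.
Qed.

Lemma subspaceBC D x y : closed_subspace D -> D (x - y) -> D (y - x).
Proof. by move=> /subspaceP[_ _ DN _] h; rewrite -opprB; exact: DN. Qed.

Lemma infconv_le_of F D x u : D (x - u) -> (infconv F (indicator_fun D) x <= F u)%E.
Proof.
move=> xu; rewrite -[leRHS]adde0 (_ : 0%E = indicator_fun D (x - u)).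
  by apply: ereal_inf_lbound; exists u.
by rewrite /indicator_fun mem_set.
Qed.

Lemma infconv_lt_ex F D x c : (forall v, -oo < F v)%E ->
  (infconv F (indicator_fun D) x < c)%E ->
  exists2 u, D (x - u) & (F u < c)%E.
Proof.
move=> FNy /ereal_inf_lt[_ [u _ <-]]; rewrite /indicator_fun.
case: ifPn => [/set_mem xu|_]; first by rewrite adde0; exists u.
by rewrite addey ?gt_eqF// => /lt_geF; rewrite leey.
Qed.

Section constraint_qualification.
Context F D (Fplc : proper_lsc_convex F) (Dcs : closed_subspace D)
  (Ycs : closed_subspace (coneD F D)).
Local Notation Y := (coneD F D).

Let perpcs := orthocomplement_closed_subspace D.

(** This is the statement that 0 belongs to the cone. *)
Lemma dual_feasible : exists2 u, eff_dom (F^*) u & perp D u.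
Proof.
have [[l /= l0 [_ [a Fa [w Dw <-]] aw]] _ _ _] := subspaceP Ycs.
move/eqP: aw; rewrite scaler_eq0 gt_eqF//= subr_eq0 => /eqP aw.
by exists a; rewrite // aw.
Qed.

Lemma perp_sub_cone w : perp D w -> Y w.
Proof.
have [u Fu uD] := dual_feasible; have [_ BD BN _] := subspaceP perpcs.
move=> wD; exists 1 => //=; exists w; last by rewrite scale1r.
exists u => //; exists (u - w); first by apply: BD => //; exact: BN.
by rewrite subKr.
Qed.

Lemma dom_sub_cone u : eff_dom (F^*) u -> Y u.
Proof.
have [B0 _ _ _] := subspaceP perpcs.
move=> Fu; exists 1 => //=; exists u; last by rewrite scale1r.
by exists u => //; exists 0 => //; rewrite subr0.
Qed.

(** Translation by e does not change the affine minorants of F, as their slopes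
    lie in the cone. *)
Lemma perp_cone_invariant e z c : perp Y e -> (F z <= c%:E)%E -> (F (z + e)%R <= c%:E)%E.
Proof.
move=> eY zc; have [u0 /dom_real[b0 /conj_leP Fmin] _] := dual_feasible.
apply: (fenchel_moreau Fplc Fmin) => u b ub.
have uY : Y u by apply: dom_sub_cone; apply: (@le_dom _ _ _ _ b); exact/conj_leP.
have := le_trans (ub z) zc; rewrite lee_fin innerDl (innerC e) eY//; lra.
Qed.

(** Once projected onto x + Y, the approximate minimizers are bounded, although F
    need not be coercive on x + D: this is where closedness of the cone and the
    uniform boundedness principle enter. *)
Lemma approximate_minimizers_limit x c :
  (forall e, 0 < e ->
    exists x' z, [/\ `|x' - x| <= e, D (z - x') & (F z <= (c + e)%:E)%E]) ->
  exists z, D (z - x) /\ (F z <= c%:E)%E.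
Proof.
move=> happ; have [[FNy _] Flsc /(convex_efunP FNy) Fcv] := Fplc.
have [D0 DD DN DZ] := subspaceP Dcs; have [Y0 YD YN YZ] := subspaceP Ycs.
pose e n : R := n.+1%:R^-1.
have e0 n : 0 < e n by rewrite invr_gt0.
have emono n p : (n <= p)%N -> e p <= e n.
  by move=> np; rewrite lef_pV2 ?posrE// ler_nat.
(* The last condition says that the projection of z - x on D^perp has norm at
   most e n, as an intersection of closed half-spaces. *)
pose S n := [set z | Y (z - x)] `&` [set z | (F z <= (c + e n)%:E)%E] `&`
  \bigcap_(w in perp D) [set z | inner z w <= inner x w + e n * `|w|].
have Sdec n p : (n <= p)%N -> S p `<=` S n.
  move=> np z [[Yz Fz] zw]; split; [split=> //|].
    by apply: le_trans Fz _; rewrite lee_fin lerD2l emono.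
  move=> w wD /=; apply: le_trans (zw _ wD) _.
  by rewrite lerD2l ler_wpM2r// emono.
(* Fenchel-Young at a and smallness on w bound z - x against y = l (a - w). *)
have [M SM] : exists M, forall z, [set z - x | z in S 0%N] z -> `|z| <= M.
  apply: weakly_bounded => y.
  have [_ [l /= l0 [_ [a Fa [w wD <-]] <-]] yp] := projection Ycs y.
  have [b /conj_leP ab] := dom_real Fa.
  exists (l * (c + e 0%N + b - inner x a + e 0%N * `|w|)) => _ [z [[Yz Fz] zw] <-].
  have := yp _ Yz; rewrite innerDr innerNr => /eqP; rewrite subr_eq0 => /eqP ->.
  rewrite innerZr ler_pM2l// innerDr innerNr !innerDl !innerNl.
  have := le_trans (ab z) Fz; rewrite lee_fin.
  have [_ _ BN _] := subspaceP perpcs.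
  by have := zw _ (BN _ wD); rewrite /= !innerNr normrN; lra.
have [||||z zS _] := @nested_closed_convex _ _ S (M + `|x|).
- move=> n; apply: closedI; first apply: closedI.
  + by apply: closed_shift; case: Ycs.
  + by apply: closed_sublevel => // v; exact: cvg_cst.
  + by apply: closed_bigI => w _; exact: closed_halfspace.
- move=> n v w t t01 [[Yv Fv] vS] [[Yw Fw] wS]; have /andP[t0 t1] := t01.
  split; [split|].
  + by rewrite /= conv_shift; apply: YD; exact: YZ.
  + rewrite /= (_ : c + e n = t * (c + e n) + (1 - t) * (c + e n)); last by ring.
    exact: Fcv.
  + move=> u uD /=; rewrite !inner_lin; have := vS _ uD; have := wS _ uD => /= h1 h2.
    have : 0 <= t * (inner x u + e n * `|u| - inner v u) by rewrite mulr_ge0; lra.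
    have : 0 <= (1 - t) * (inner x u + e n * `|u| - inner w u) by rewrite mulr_ge0; lra.
    by lra.
- by [].
- move=> n; have [x' [z0 [x'x z0D Fz0]]] := happ _ (e0 n).
  (* Dropping the component of z0 - x orthogonal to Y changes neither F nor the
     inner products with D^perp. *)
  have [p Yp zp] := projection Ycs (z0 - x).
  have Sz : S n (x + p).
    have [_ _ BN _] := subspaceP (orthocomplement_closed_subspace Y).
    split; [split|].
    + by rewrite /= addrC addKr.
    + rewrite /= (_ : x + p = z0 + - (z0 - x - p)); last first.
        by rewrite !opprD !opprK addrA addrA subrr add0r.
      by apply: perp_cone_invariant => //; exact: BN.
    + move=> w wD /=; rewrite innerDl lerD2l.
      have := zp _ (perp_sub_cone wD); have := wD _ z0D.
      have := inner_le_norm (x' - x) w.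
      have : `|x' - x| * `|w| <= e n * `|w| by rewrite ler_wpM2r.
      by rewrite !inner_lin (innerC w z0) (innerC w x) (innerC w p); lra.
  exists (x + p) => //.
  have := SM _ (imageP _ (Sdec _ _ (leq0n n) _ Sz)); rewrite addrAC subrr add0r => pM.
  by rewrite addrC; apply: (le_trans (ler_normD _ _)); rewrite lerD2r.
have small a b (t : R) : 0 <= t -> (forall n, a <= b + e n * t) -> a <= b.
  move=> t0 h; apply/ler_addgt0Pr => d d0.
  have d1 : 0 < d / (t + 1) by rewrite divr_gt0// ltr_wpDl.
  have [n _ /(_ n (leqnn n)) /= en] := near_infty_natSinv_lt (PosNum d1).
  apply: (le_trans (h n)); rewrite lerD2l.
  apply: (@le_trans _ _ (d / (t + 1) * (t + 1))); last first.
    by rewrite divfK// gt_eqF// ltr_wpDl.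
  apply: ler_pM => //; [exact: ltW|exact: ltW|].
  by rewrite lerDl.
exists z; split.
  rewrite -(orthocomplementK Dcs) => w wD.
  have [_ _ BN _] := subspaceP perpcs.
  have h1 : inner z w <= inner x w.
    by apply: (small _ _ `|w|) => // n; have [_] := zS n; apply.
  have h2 : inner z (- w) <= inner x (- w).
    by apply: (small _ _ `|- w|) => // n; have [_] := zS n; apply; exact: BN.
  apply/le_anti; move: h1 h2; rewrite !inner_lin !(innerC w) => ? ?.
  by apply/andP; split; lra.
have [r Er] : exists r, F z = r%:E.
  have [[_]] := zS 0%N.
  by move: (FNy z) => /=; case: (F z) => [r| |]//; exists r.
rewrite Er lee_fin; apply: (small _ _ 1) => // n.
by have [[_ +] _] := zS n; rewrite /= Er lee_fin mulr1.
Qed.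

(** Attainment uses approximate_minimizers_limit with x' = x, lower
    semicontinuity uses it with x' tending to x. *)
Lemma attouch_brezis :
  proper_lsc_convex (infconv F (indicator_fun D)) /\
  forall x, infconv_exact_at F (indicator_fun D) x.
Proof.
set h := infconv _ _.
have [[FNy [x0 x0F]] Flsc /(convex_efunP FNy) Fcv] := Fplc.
have [D0 DD DN DZ] := subspaceP Dcs.
have [u0 /dom_real[b0 /conj_leP Fmin] u0D] := dual_feasible.
have hmin x : ((inner x u0 - b0)%:E <= h x)%E.
  apply: le_ereal_inf_tmp => _ [u _ <-]; rewrite /indicator_fun.
  case: ifPn => [/set_mem xu|_]; last by rewrite addey ?gt_eqF ?leey.
  rewrite adde0; apply: le_trans (Fmin u); rewrite lee_fin.
  by have := u0D _ xu; rewrite innerDl innerNl; lra.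
have hNy x : (-oo < h x)%E by apply: lt_le_trans (hmin x); exact: ltNyr.
have attained x c : (h x <= c%:E)%E -> exists z, D (z - x) /\ (F z <= c%:E)%E.
  move=> hc; apply: approximate_minimizers_limit => e e0.
  have : (h x < (c + e)%:E)%E by apply: le_lt_trans hc _; rewrite lte_fin ltrDl.
  move=> /(infconv_lt_ex FNy)[z xz Fz]; exists x, z; split.
  - by rewrite subrr normr0 ltW.
  - exact: subspaceBC.
  - exact: ltW.
split; last first.
  move=> x; have hx := hNy x; rewrite /infconv_exact_at -/h.
  case Ex : (h x) hx => [c| |] // _; last first.
    exists x; apply/esym/eqP; rewrite -leye_eq -Ex.
    by apply: ereal_inf_lbound; exists x.
  have [|z [zx Fz]] := attained x c; first by rewrite Ex.
  have xz := subspaceBC Dcs zx.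
  exists z; rewrite /indicator_fun mem_set// adde0.
  by apply/le_anti; rewrite Fz andbT -Ex infconv_le_of.
split.
- split=> //; exists x0; apply: le_lt_trans x0F.
  by apply: infconv_le_of; rewrite subrr.
- move=> x a; rewrite ltNge => /negP ax; apply: contrapT => nV; apply: ax.
  have [|z [zx Fz]] := @approximate_minimizers_limit x a; last first.
    by apply: le_trans Fz; apply: infconv_le_of; exact: subspaceBC.
  move=> e e0; apply: contrapT => nx; apply: nV; exists (ball x e).
    by apply: nbhsx_ballx.
  move=> x'; rewrite -ball_normE /= => xx'; rewrite ltNge; apply/negP => hx'.
  have [z [zx' Fz]] := attained _ _ hx'.
  apply: nx; exists x', z; split=> //; first by rewrite distrC ltW.
  by apply: le_trans Fz _; rewrite lee_fin lerDl ltW.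
- apply/convex_efunP => // x y t a b t01 /attained[z [zx Fz]] /attained[w [wy Fw]].
  apply: le_trans (Fcv _ _ _ _ _ t01 Fz Fw); apply: infconv_le_of.
  apply: subspaceBC => //.
  rewrite (_ : _ - _ = t *: (z - x) + (1 - t) *: (w - y)); last first.
    by rewrite !scalerBr addrACA -opprD.
  by apply: DD; exact: DZ.
Qed.

End constraint_qualification.
End attouch_brezis.

(** * From coercivity to the conjugate qualification condition *)

Section sufficient_conditions.
Context (R : realType) (H : hilbertType R).
Implicit Types (F : H -> \bar R) (C D Y : set H) (x y z u v w : H).
Local Notation "F ^*" := (fenchel_conj F).
Local Notation perp := orthocomplement.

Lemma closed_subspaceT : closed_subspace [set: H].
Proof. by split; [exact: closedT|apply/submodP]. Qed.

Lemma conical_hull_nbhs0 C e : 0 < e -> (forall w, `|w| <= e -> C w) ->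
  closed_subspace (conical_hull C).
Proof.
move=> e0 Ce; rewrite (_ : conical_hull C = setT); first exact: closed_subspaceT.
apply/seteqP; split=> // y _; pose l := (`|y| + 1) / e.
have y1 : 0 < `|y| + 1 by rewrite ltr_wpDl.
have l0 : 0 < l by rewrite divr_gt0.
exists l => //; exists (l^-1 *: y); last by rewrite scalerA divff ?gt_eqF// scale1r.
apply: Ce; rewrite normrZ gtr0_norm ?invr_gt0//.
by rewrite /l invf_div mulrAC ler_pdivrMr// ler_pM2l// lerDl.
Qed.

Lemma affine_bounded_above (a s c : R) : (forall t, a + t * s <= c) -> s = 0.
Proof.
move=> h; apply/eqP; apply: contrapT => /negP s0.
by have := h ((c - a + 1) / s); rewrite divfK//; lra.
Qed.

Definition coercive_on D F :=
  forall M : R, exists r : R, forall x, D x -> r < `|x| -> (M%:E < F x)%E.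

(** Outside a ball of radius rho around d0, F exceeds its value at d0 by more
    than 1; along a segment issued from d0, convexity then forces growth with
    slope at least 1 / rho. Inside the ball, the affine minorant given by u0
    bounds F from below, being constant on D. *)
Lemma coercive_linear_growth F D u0 d0 : proper_lsc_convex F -> closed_subspace D ->
  eff_dom (F^*) u0 -> perp D u0 -> eff_dom F d0 -> D d0 -> coercive_on D F ->
  exists2 e, 0 < e & exists B, forall x, D x -> ((e * `|x| - B)%:E <= F x)%E.
Proof.
move=> [[FNy _] _ /(convex_efunP FNy) Fcv] Dcs /dom_real[b0 /conj_leP Fmin] u0D.
move=> /dom_real[s0 Fd0] Dd0 Fcoer.
have [_ DD DN DZ] := subspaceP Dcs.
have Fb x : D x -> ((- b0)%:E <= F x)%E.
  by move=> Dx; have := Fmin x; rewrite u0D// sub0r.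
have [r Fr] := Fcoer (s0 + 1).
pose rho := `|r| + `|d0| + 1.
have rho0 : 0 < rho by rewrite ltr_wpDl// addr_ge0.
exists rho^-1; rewrite ?invr_gt0//; exists (`|d0| / rho + 1 + `|b0| + `|s0|).
move=> x Dx.
have xd : `|x| <= `|x - d0| + `|d0| by have := ler_normD (x - d0) d0; rewrite subrK.
have {}xd : rho^-1 * `|x| <= rho^-1 * `|x - d0| + `|d0| / rho.
  by rewrite [`|d0| / _]mulrC -mulrDr ler_pM2l ?invr_gt0.
have hb := ler_norm b0; have hs := ler_norm (- s0); rewrite normrN in hs.
have hb' := normr_ge0 b0; have hs' := normr_ge0 s0.
have [xrho|rhox] := leP `|x - d0| rho.
  apply: le_trans (Fb _ Dx); rewrite lee_fin.
  have : rho^-1 * `|x - d0| <= 1 by rewrite mulrC ler_pdivrMr// mul1r.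
  by lra.
apply: le_real => a Fa; rewrite lee_fin.
have n0 : 0 < `|x - d0| by apply: lt_trans rhox.
pose t := rho / `|x - d0|.
have t0 : 0 < t by rewrite divr_gt0.
have t1 : t < 1 by rewrite ltr_pdivrMr// mul1r.
have t01 : 0 < t < 1 by rewrite t0.
have Dz : D (t *: x + (1 - t) *: d0) by apply: DD; exact: DZ.
have zr : r < `|t *: x + (1 - t) *: d0|.
  rewrite (_ : _ + _ = d0 + t *: (x - d0)); last first.
    by rewrite scalerBl scale1r scalerBr addrCA.
  have := ler_normB (d0 + t *: (x - d0)) d0; rewrite addrAC subrr add0r.
  rewrite normrZ (gtr0_norm t0) divfK ?gt_eqF// /rho.
  by have := ler_norm r; lra.
have /lt_le_trans/(_ (Fcv _ _ _ _ _ t01 Fa Fd0)) := Fr _ Dz zr; rewrite lte_fin => h.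
have : 1 < t * (a - s0) by lra.
rewrite /t mulrAC ltr_pdivlMr// mul1r -ltr_pdivrMl// => h'.
by lra.
Qed.

(** Let k be the infimal convolution of F* with the indicator of D^perp. The
    primal qualification lets attouch_brezis apply to F*, so k is lower
    semicontinuous and is recovered from its affine minorants. These have the
    form <., v> - b with v in D and b >= F v, so linear growth of F on D bounds
    them uniformly on a ball. Finiteness of k on that ball means that the ball is
    contained in dom F* - D^perp. *)
Lemma coercive_qualification F D : proper_lsc_convex F -> closed_subspace D ->
  eff_dom (F^*) `&` perp D !=set0 -> coercive_on D F ->
  closed_subspace (conical_hull (minkowski_diff (eff_dom F) D)) ->
  closed_subspace (conical_hull (minkowski_diff (eff_dom (F^*)) (perp D))).
Proof.
move=> Fplc Dcs [u0 [Fu0 u0D]] Fcoer Fcq.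
have Pcs := orthocomplement_closed_subspace D.
have Fne : eff_dom (F^*) !=set0 by exists u0.
have FcP : proper_lsc_convex (F^*) by apply: conj_plc Fne; case: Fplc.
have Fcc := conj_conj Fplc Fne.
have FcC : closed_subspace
    (conical_hull (minkowski_diff (eff_dom (F^*^*)) (perp (perp D)))).
  by rewrite Fcc orthocomplementK.
have [kplc kex] := attouch_brezis FcP Pcs FcC.
set k := infconv _ _ in kplc kex.
have [d0] := dual_feasible FcC.
rewrite Fcc orthocomplementK// => Fd0 Dd0.
have [e e0 [B FB]] := coercive_linear_growth Fplc Dcs Fu0 u0D Fd0 Dd0 Fcoer.
apply: (conical_hull_nbhs0 e0) => w we.
have [[FcNy _] _ _] := FcP.
have kmin b : (F d0 <= b%:E)%E -> is_minorant k d0 b.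
  move=> Fb x; rewrite leNgt; apply/negP => /(infconv_lt_ex FcNy)[a xa].
  apply/negP; rewrite -leNgt.
  have : (F^*^* d0 <= b%:E)%E by rewrite Fcc.
  move=> /conj_leP/(_ a); congr (_ <= _)%E; congr (_ - _)%:E; rewrite !(innerC _ d0).
  by have := xa _ Dd0; rewrite innerDr innerNr; lra.
have [s0 Fs0] := dom_real Fd0.
have kw : (k w <= B%:E)%E.
  apply: (fenchel_moreau kplc (kmin _ Fs0)) => v b kv.
  (* Otherwise the minorant would be unbounded above on a line u0 + t z with z in
     D^perp, where k is at most F* u0. *)
  have Dv : D v.
    rewrite -(orthocomplementK Dcs) => z zD; have [b0 Fb0] := dom_real Fu0.
    apply: (@affine_bounded_above (inner u0 v - b) _ b0) => t.
    have : (k (u0 + t *: z)%R <= b0%:E)%E.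
      apply: le_trans Fb0; apply: infconv_le_of; rewrite addrAC subrr add0r.
      by have [_ _ _ PZ] := subspaceP Pcs; exact: PZ.
    by move=> /(le_trans (kv _)); rewrite lee_fin innerDl innerZl; lra.
  have Fv : (F v <= b%:E)%E.
    have [b0 /conj_leP Fmin] := dom_real Fu0.
    apply: (fenchel_moreau Fplc Fmin) => u c /conj_leP uc.
    have : (k u <= c%:E)%E.
      by apply: le_trans uc; apply: infconv_le_of; rewrite subrr; case: (subspaceP Pcs).
    by move=> /(le_trans (kv _)); rewrite lee_fin innerC; lra.
  have := le_trans (FB _ Dv) Fv; rewrite lee_fin.
  have := inner_le_norm w v.
  have : `|w| * `|v| <= e * `|v| by rewrite ler_wpM2r.
  by lra.
have [|a wa Fa] := @infconv_lt_ex _ _ (F^*) (perp D) w +oo%E FcNy.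
  by apply: le_lt_trans kw _; exact: ltry.
exists a => //; exists (a - w); last by rewrite subKr.
exact: (subspaceBC Pcs wa).
Qed.

End sufficient_conditions.

(** * Finite dimension and relative interiors *)

Section finite_dimension.
Context (R : realType) (H : hilbertType R) (N : nat) (phi : H -> 'rV[R]_N).
Hypotheses (phi_lin : linear phi) (phi_inj : injective phi).
Local Notation perp := orthocomplement.

Let phi0 : phi 0 = 0.
Proof. by apply: (@addrI _ (phi 0)); rewrite -{1}[phi 0]scale1r -phi_lin scale1r !addr0. Qed.

Let phi_sum k (a : 'I_k -> R) (e : 'I_k -> H) :
  phi (\sum_i a i *: e i) = \sum_i a i *: phi (e i).
Proof.
elim/big_rec2: _ => [|i x y _ <-]; [exact: phi0|exact: phi_lin].
Qed.

Definition orthonormal_family k (e : 'I_k -> H) :=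
  forall i j, inner (e i) (e j) = (i == j)%:R.

Lemma inner_orthonormal k (e : 'I_k -> H) (a : 'I_k -> R) j :
  orthonormal_family e -> inner (\sum_i a i *: e i) (e j) = a j.
Proof.
move=> eo; rewrite inner_suml (bigD1 j)//= big1 => [|i /negPf ij].
  by rewrite innerZl eo eqxx mulr1 addr0.
by rewrite innerZl eo ij mulr0.
Qed.

Lemma orthonormal_size k (e : 'I_k -> H) : orthonormal_family e -> (k <= N)%N.
Proof.
move=> eo; rewrite leqNgt; apply/negP => Nk.
pose A : 'M[R]_(k, N) := \matrix_(i < k) phi (e i).
have : kermx A != 0.
  rewrite kermx_eq0 /row_free neq_ltn; apply/orP; left.
  exact: leq_ltn_trans (rank_leq_col A) Nk.
rewrite -nz_row_eq0; set u := nz_row _ => u0.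
have /sub_kermxP uA : (u <= kermx A)%MS by exact: nz_row_sub.
have : \sum_i u 0 i *: e i = 0.
  apply: phi_inj; rewrite phi0 phi_sum -[RHS]uA mulmx_sum_row.
  by apply: eq_bigr => i _; rewrite rowK.
move=> ue; move/eqP: u0; apply; apply/rowP => j; rewrite mxE.
by rewrite -(inner_orthonormal (fun i => u 0 i) j eo) ue inner0l.
Qed.

(** A maximal orthonormal family in Y spans Y, and then its orthogonal
    expansion Q shows that Y is its own double orthogonal complement. *)
Lemma finite_dim_closed_subspace (Y : set H) :
  submod_closed (mem Y) -> closed_subspace Y.
Proof.
move=> /submodP[Y0 YL].
have YZ a x : Y x -> Y (a *: x) by move=> Yx; rewrite -[_ *: _]addr0; exact: YL.
have YD x y : Y x -> Y y -> Y (x + y).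
  by move=> Yx Yy; rewrite -[x]scale1r; exact: YL.
pose P k := `[< exists2 e : 'I_k -> H, forall i, Y (e i) & orthonormal_family e >].
have P0 : exists k, P k.
  exists 0%N; apply/asboolP; exists (fun=> 0) => //; by case.
have PN k : P k -> (k <= N)%N by move=> /asboolP[e _ /orthonormal_size].
case: (ex_maxnP P0 PN) => k /asboolP[e eY eo] kmax.
pose Q x := \sum_i inner x (e i) *: e i.
have QY x : Y (Q x) by rewrite /Q; elim/big_ind: _ => // i _; exact: YZ.
have Qe x i : inner (x - Q x) (e i) = 0.
  by rewrite innerDl innerNl inner_orthonormal// subrr.
have QK y : Y y -> y = Q y.
  move=> Yy; apply/eqP; rewrite -subr_eq0; apply: contrapT => /negP.
  set r := y - Q y => r0.
  suff /kmax : P k.+1 by rewrite ltnn.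
  have Yr : Y r by apply: YD => //; rewrite -scaleN1r; exact: YZ.
  have rn : inner (`|r|^-1 *: r) (`|r|^-1 *: r) = 1.
    by rewrite innerZl innerZr inner_norm expr2 mulKf ?mulVf// normr_eq0.
  apply/asboolP; exists (fun i => oapp e (`|r|^-1 *: r) (unlift ord_max i)).
    by move=> i; case: unliftP => [j|] _ /=; [exact: eY|exact: YZ].
  move=> i j; case: unliftP => [i'|] ->; case: unliftP => [j'|] -> /=.
  - by rewrite eo (inj_eq lift_inj).
  - by rewrite innerC innerZl Qe mulr0 eq_sym (negPf (neq_lift _ _)).
  - by rewrite innerZl Qe mulr0 (negPf (neq_lift _ _)).
  - by rewrite rn eqxx.
rewrite (_ : Y = perp (perp Y)); first exact: orthocomplement_closed_subspace.
apply/seteqP; split=> [y Yy u uY|x xY]; first by rewrite innerC uY.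
have xQ : perp Y (x - Q x).
  move=> y Yy; rewrite innerC (QK _ Yy) /Q inner_sumr big1// => i _.
  by rewrite innerZr Qe mulr0.
suff /inner_eq0/subr0_eq -> : inner (x - Q x) (x - Q x) = 0 by [].
by rewrite innerDr innerNr xY// innerC xQ// subr0.
Qed.

End finite_dimension.

Section relative_interior.
Context (R : realType) (H : hilbertType R).

(** Since - (c - v) is 1/t times (w + t (w - c)) - (w + t (w - v)), prolonging
    the segment from c to w beyond w makes the cone symmetric. *)
Lemma relative_interior_cone (C P : set H) w : convex_set C -> closed_subspace P ->
  C w -> P w ->
  (forall c, C c -> exists2 t, 0 < t & C (w + t *: (w - c))) ->
  submod_closed (mem (conical_hull (minkowski_diff C P))).
Proof.
move=> Ccv Pcs Cw Pw Cri; set K := conical_hull _.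
have [P0 PD PN PZ] := subspaceP Pcs.
have K0 : K 0.
  by exists 1 => //=; exists 0; rewrite ?scaler0//; exists w => //; exists w; rewrite ?subrr.
have KD x y : K x -> K y -> K (x + y).
  move=> [l /= l0 [_ [c Cc [v Pv <-]] <-]] [l' /= l'0 [_ [c' Cc' [v' Pv' <-]] <-]].
  have ll : 0 < l + l' by rewrite addr_gt0.
  have ll' : l + l' != 0 by rewrite gt_eqF.
  pose t := l / (l + l').
  have t01 : 0 < t < 1 by rewrite divr_gt0//= ltr_pdivrMr// mul1r ltrDl.
  have E1 : (l + l') * t = l by rewrite mulrC divfK.
  have E2 : (l + l') * (1 - t) = l' by rewrite mulrBr E1; lra.
  exists (l + l') => //; exists (t *: (c - v) + (1 - t) *: (c' - v')).
    exists (t *: c + (1 - t) *: c'); first exact: Ccv.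
    exists (t *: v + (1 - t) *: v'); first by apply: PD; exact: PZ.
    by rewrite !scalerBr addrACA -opprD.
  by rewrite scalerDr !scalerA E1 E2.
have KZ a x : 0 < a -> K x -> K (a *: x).
  by move=> a0 [l /= l0 [c cC <-]]; exists (a * l); rewrite /= ?mulr_gt0//; exists c; rewrite ?scalerA.
have KN x : K x -> K (- x).
  move=> [l /= l0 [_ [c Cc [v Pv <-]] <-]].
  have [t t0 Ct] := Cri _ Cc.
  exists (l / t); rewrite /= ?divr_gt0//; exists (- (t *: (c - v))); last first.
    by rewrite scalerN scalerA divfK ?gt_eqF.
  exists (w + t *: (w - c)) => //; exists (w + t *: (w - v)).
    by apply: (PD) => //; apply: PZ; apply: PD => //; exact: PN.
  rewrite opprD addrACA subrr add0r -scalerBr -scalerN opprB opprB.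
  by rewrite [w - c + _]addrC addrA subrK.
apply/submodP; split=> // a x y Kx Ky; apply: KD => //.
have [a0|a0|->] := ltgtP a 0; last by rewrite scale0r.
  by rewrite -[a]opprK scaleNr -scalerN; apply: KZ; rewrite ?oppr_gt0//; exact: KN.
exact: KZ.
Qed.

Lemma relative_interior_extend (C : set H) w c : relative_interior C w -> C c ->
  \forall t \near (0 : R), C (w + t *: (w - c)).
Proof.
move=> [Cw wC] Cc.
have aff t : affine_hull C (w + t *: (w - c)).
  move=> A [Aaff CA].
  rewrite (_ : _ + _ = (1 + t) *: w + (1 - (1 + t)) *: c).
    by apply: Aaff; exact: CA.
  by rewrite opprD addrA subrr sub0r scaleNr scalerDl scale1r scalerBr addrA.
have cont : (w + t *: (w - c)) @[t --> (0 : R)] --> w.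
  rewrite -[X in _ --> X]addr0 -[X in _ --> _ + X](scale0r (w - c)).
  apply: cvgD; first exact: cvg_cst.
  by apply: cvgZr_tmp; exact: cvg_id.
have near0 : \forall t \near (0 : R), affine_hull C (w + t *: (w - c)) ->
    C (w + t *: (w - c)) := cont _ wC.
by near=> t; apply: (near near0 t) => //; exact: aff.
Unshelve. all: by end_near.
Qed.

End relative_interior.

(** * Direct sums on the product space *)

Lemma adde_gtNy (R : realType) (a b : \bar R) : (-oo < a -> -oo < b -> -oo < a + b)%E.
Proof. by case: a b => [a| |] [b| |]// _ _; rewrite -EFinD ltNyr. Qed.

Lemma lower_semicontinuousD (R : realType) (T : topologicalType) (g h : T -> \bar R) :
  (forall x, -oo < g x)%E -> (forall x, -oo < h x)%E ->
  lower_semicontinuous g -> lower_semicontinuous h ->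
  lower_semicontinuous (fun x => g x + h x)%E.
Proof.
move=> gNy hNy glsc hlsc x a ax.
have [s [t [sg th ast]]] : exists s t, [/\ (s%:E < g x)%E, (t%:E < h x)%E & a <= s + t].
  move: (gNy x) (hNy x) ax; case: (g x) => [r| |]// _; case: (h x) => [r'| |]// _.
  - rewrite -EFinD lte_fin => h0; exists (r - (r + r' - a) / 2), (r' - (r + r' - a) / 2).
    by rewrite !lte_fin; split; lra.
  - by move=> _; exists (r - 1), (a - r + 1); rewrite lte_fin ltry; split=> //; lra.
  - by move=> _; exists (a - r' + 1), (r' - 1); rewrite lte_fin ltry; split=> //; lra.
  - by move=> _; exists a, 0; rewrite !ltry addr0.
have [V Vx Vg] := glsc _ _ sg; have [W Wx Wh] := hlsc _ _ th.
exists (V `&` W); first exact: filterI.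
move=> y [/Vg gy /Wh hy]; apply: (@le_lt_trans _ _ (s + t)%:E); first by rewrite lee_fin.
by rewrite EFinD lteD.
Qed.

Lemma nonexpansive_continuous (R : realType) (H K : hilbertType R) (g : H -> K) :
  (forall x y, `|g x - g y| <= `|x - y|) -> continuous g.
Proof.
move=> gx x; apply/cvgrPdist_lt => e e0; near=> y.
apply: (le_lt_trans (gx _ _)); near: y; apply/nbhs_ballP.
by exists e => // y; rewrite -ball_normE.
Unshelve. all: by end_near. Qed.

Section product_space.
Context (R : realType) (X : hilbertType R) (m : nat).
Local Notation XX := (prodH X m).
Local Notation perp := orthocomplement.
Implicit Types (x u w : XX) (f : 'I_m -> X -> \bar R).

Lemma prodH_innerE x u : inner x u = \sum_i inner (x i) (u i).
Proof. by []. Qed.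

Lemma component_continuous i : continuous (fun x : XX => x i).
Proof.
apply: nonexpansive_continuous => x y.
rewrite -ler_sqr ?nnegrE// -!inner_norm prodH_innerE (bigD1 i)//=.
rewrite !ffunE lerDl; apply: sumr_ge0 => j _.
by rewrite inner_norm sqr_ge0.
Qed.

(** Lets direct sums be compared termwise, over the real numbers. *)
Lemma direct_sum_leP f x c : (forall i y, -oo < f i y)%E ->
  (direct_sum f x <= c%:E)%E <->
  exists s : 'I_m -> R, (forall i, (f i (x i) <= (s i)%:E)%E) /\ \sum_i s i <= c.
Proof.
move=> fNy; split=> [h|[s [fs sc]]]; last first.
  apply: (@le_trans _ _ (\sum_i (s i)%:E)%E); first exact: lee_sum.
  by rewrite sumEFin lee_fin.
have ffin i : f i (x i) \is a fin_num.
  rewrite fin_numE gt_eqF//=; apply/eqP => fy.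
  move: h; rewrite /direct_sum (bigD1 i)//= fy addye//.
  rewrite gt_eqF//; by elim/big_ind: _ => // a b; exact: adde_gtNy.
exists (fun i => fine (f i (x i))); split=> [i|]; first by rewrite fineK.
by rewrite -lee_fin -sumEFin; under eq_bigr do rewrite fineK//.
Qed.

Lemma eff_dom_direct_sum f : (forall i y, -oo < f i y)%E ->
  eff_dom (direct_sum f) = set_prod (fun i => eff_dom (f i)).
Proof.
move=> fNy; apply/seteqP; split=> x.
  by move=> /dom_real[c /(direct_sum_leP _ _ fNy)[s [fs _]]] i; exact: le_dom (fs i).
move=> xf; have s_ i : {s | (f i (x i) <= s%:E)%E} by apply: cid; exact: dom_real.
apply: (@le_dom _ _ _ _ (\sum_i sval (s_ i))); apply/direct_sum_leP => //.
by exists (fun i => sval (s_ i)); split=> // i; case: (s_ i).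
Qed.

Lemma direct_sum_gtNy f x : (forall i y, -oo < f i y)%E -> (-oo < direct_sum f x)%E.
Proof.
move=> fNy; rewrite /direct_sum; by elim/big_ind: _ => // a b; exact: adde_gtNy.
Qed.

Lemma direct_sum_plc f : (forall i, proper_lsc_convex (f i)) ->
  proper_lsc_convex (direct_sum f).
Proof.
move=> fplc; have fNy i y : (-oo < f i y)%E by have [[+ _] _ _] := fplc i; apply.
split.
- split=> [x|]; first exact: direct_sum_gtNy.
  rewrite eff_dom_direct_sum//.
  have x_ i : {x | eff_dom (f i) x} by apply: cid; have [[]] := fplc i.
  by exists [ffun i => sval (x_ i)] => i; rewrite ffunE; case: (x_ i).
- rewrite (_ : direct_sum f = fun x => (\sum_(i <- index_enum 'I_m) f i (x i))%E)//.
  elim: (index_enum _) => [|i s IH].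
    move=> x a; rewrite big_nil => a0; exists setT; first exact: filterT.
    by move=> y _; rewrite big_nil.
  rewrite (_ : (fun _ => _) =
     (fun x : XX => f i (x i) + \sum_(i <- s) f i (x i))%E); last first.
    by apply/funext => x; rewrite big_cons.
  apply: lower_semicontinuousD => // x.
    by elim/big_ind: _ => // a b; exact: adde_gtNy.
  move=> a ax; have [_ flsc _] := fplc i; have [V Vx Vf] := flsc _ _ ax.
  exists ((fun x : XX => x i) @^-1` V); first exact: component_continuous.
  by move=> y; exact: Vf.
- apply/convex_efunP => [x|x y t a b t01]; first exact: direct_sum_gtNy.
  have /andP[t0 t1] := t01.
  move=> /(direct_sum_leP _ _ fNy)[s [fs sa]] /(direct_sum_leP _ _ fNy)[s' [fs' sb]].
  apply/direct_sum_leP => //; exists (fun i => t * s i + (1 - t) * s' i); split=> [i|].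
    have [_ _ /(convex_efunP (fNy i)) fcv] := fplc i.
    by rewrite !ffunE; apply: fcv.
  rewrite big_split /= -!mulr_sumr lerD// ler_pM2l// subr_gt0//.
Qed.

(** A minorant of the direct sum, restricted to the points that differ from a
    fixed point of the domain only in coordinate i, is a minorant of f i. *)
Lemma eff_dom_conj_direct_sum f : (forall i, proper_fun (f i)) ->
  eff_dom (fenchel_conj (direct_sum f)) =
  set_prod (fun i => eff_dom (fenchel_conj (f i))).
Proof.
move=> fproper; have fNy i y : (-oo < f i y)%E by have [+ _] := fproper i; apply.
apply/seteqP; split=> u; last first.
  move=> uf.
  have b_ i : {b | (fenchel_conj (f i) (u i) <= b%:E)%E} by apply: cid; exact: dom_real.
  apply: (@le_dom _ _ _ _ (\sum_i sval (b_ i))); apply/conj_leP => x.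
  rewrite prodH_innerE -sumrB -sumEFin; apply: lee_sum => i _.
  by case: (b_ i) => b /= /conj_leP; apply.
have x_ i : {x : X & {s | (f i x <= s%:E)%E}}.
  have /cid[x /dom_real/cid[s xs]] : eff_dom (f i) !=set0 by have [] := fproper i.
  by exists x, s.
move=> /dom_real[b /conj_leP ub] i.
pose x0 j := projT1 (x_ j); pose s0 j := sval (projT2 (x_ j)).
have xs j : (f j (x0 j) <= (s0 j)%:E)%E by rewrite /x0 /s0; case: (x_ j) => x [].
pose c := b + \sum_(j | j != i) (s0 j - inner (x0 j) (u j)).
apply: (@le_dom _ _ _ _ c); apply/conj_leP => y; apply: le_real => a ya.
pose x : XX := [ffun j => if j == i then y else x0 j].
pose s j := if j == i then a else s0 j.
have : (direct_sum f x <= (\sum_j s j)%:E)%E.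
  apply/direct_sum_leP => //; exists s; split=> // j.
  by rewrite ffunE /s; case: eqP => [->|].
move=> /(le_trans (ub x)); rewrite !lee_fin prodH_innerE (bigD1 i)//= [leRHS](bigD1 i)//=.
rewrite ffunE /s eqxx /c => h.
rewrite (eq_bigr (fun j => inner (x0 j) (u j))) in h; last first.
  by move=> j /negPf ji; rewrite ffunE ji.
rewrite [X in _ <= _ + X](eq_bigr s0) in h; last by move=> j /negPf ->.
by rewrite sumrB; lra.
Qed.

(** Closedness comes from writing the diagonal as an orthogonal complement, of
    the vectors with v at place i, - v at place i0 and 0 elsewhere. *)
Lemma diag_closed_subspace : (0 < m)%N -> closed_subspace (diag_space X m).
Proof.
move=> m0; pose i0 := Ordinal m0.
pose single i (v : X) : XX := [ffun k => if k == i then v else 0].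
have singleE i v x : inner (single i v) x = inner v (x i).
  rewrite prodH_innerE (bigD1 i)//= big1 => [|k /negPf ki]; rewrite ffunE ?ki ?inner0l//.
  by rewrite eqxx addr0.
rewrite (_ : diag_space X m = perp [set w | exists i v, w = single i v - single i0 v]).
  exact: orthocomplement_closed_subspace.
apply/seteqP; split=> [_ [d _ <-] _ [i [v ->]]|x xp].
  by rewrite innerDl innerNl !singleE !ffunE subrr.
exists (x i0) => //; apply/ffunP => i; rewrite ffunE; apply/esym/eqP.
rewrite -subr_eq0; apply/eqP/inner_eq0.
rewrite innerDr innerNr -!singleE -innerNl -innerDl; apply: xp.
by exists i, (x i - x i0).
Qed.

Lemma coercive_on_diag f : coercive (fun d : X => \sum_(i < m) f i d)%E ->
  coercive_on (diag_space X m) (direct_sum f).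
Proof.
move=> fcoer M; have [r fr] := fcoer M; exists (m%:R * `|r|) => _ [d _ <-] dr.
rewrite /direct_sum; under eq_bigr do rewrite ffunE; apply: fr.
rewrite ltNge; apply/negP => dle; move: dr; apply/negP; rewrite -leNgt.
have mr0 : 0 <= m%:R * `|r| by rewrite mulr_ge0.
rewrite -ler_sqr ?nnegrE// -inner_norm prodH_innerE.
under eq_bigr do rewrite ffunE inner_norm.
rewrite sumr_const card_ord -[leLHS]mulr_natl exprMn.
have dr : `|d| <= `|r| by apply: le_trans dle (ler_norm r).
apply: ler_pM => //; last by rewrite ler_sqr ?nnegrE.
by rewrite -natrX ler_nat; case: (m) => // k; rewrite expnS expn1 leq_pmulr.
Qed.

Lemma prodH_finite_dim_closed (Y : set XX) : finite_dimensional X ->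
  submod_closed (mem Y) -> closed_subspace Y.
Proof.
move=> [n [[v2r v2r_lin v2r_bij]]].
pose phi x : 'rV[R]_(m * n) := mxvec (\matrix_(i < m, j < n) v2r (x i) 0 j).
apply: (@finite_dim_closed_subspace _ _ _ phi) => [a x y|x y].
  rewrite /phi -linearZ -linearD /=; congr mxvec; apply/matrixP => i j.
  by rewrite !mxE !ffunE v2r_lin !mxE.
move=> /(can_inj mxvecK)/matrixP e; apply/ffunP => i.
by apply: (bij_inj v2r_bij); apply/rowP => j; have := e i j; rewrite !mxE.
Qed.

End product_space.

Theorem proposition5p1 (R : realType) (X : hilbertType R) (m : nat)
    (m_gt0 : (0 < m)%N) (f : 'I_m -> X -> \bar R)
    (f_plc : forall i, proper_lsc_convex (f i))
    (standing : eff_dom (fenchel_conj (direct_sum f))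
                  `&` orthocomplement (diag_space X m) !=set0)
    (hyp :
      (* (i) *)
      closed_subspace (conical_hull
        (minkowski_diff (set_prod (fun i => eff_dom (fenchel_conj (f i))))
                 (orthocomplement (diag_space X m))))
      (* (ii) *)
      \/ (coercive (fun d : X => \sum_(i < m) f i d)%E
          /\ closed_subspace (conical_hull
               (minkowski_diff (set_prod (fun i => eff_dom (f i))) (diag_space X m))))
      (* (iii) *)
      \/ set_prod (fun i => eff_dom (fenchel_conj (f i))) = [set: prodH X m]
      (* (iv) *)
      \/ (exists x : prodH X m,
            [/\ orthocomplement (diag_space X m) x,
                eff_dom (direct_sum (fun i => fenchel_conj (f i))) x
              & {for x, continuous (direct_sum (fun i => fenchel_conj (f i)))}])
      (* (v) *)
      \/ (finite_dimensional X
          /\ set_prod (fun i => relative_interior (eff_dom (fenchel_conj (f i))))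
               `&` orthocomplement (diag_space X m) !=set0)) :
  proper_lsc_convex (infconv (direct_sum f) (indicator_fun (diag_space X m)))
  /\ forall x : prodH X m,
       infconv_exact_at (direct_sum f) (indicator_fun (diag_space X m)) x.
Proof.
have fproper i : proper_fun (f i) by have [] := f_plc i.
have Fplc := direct_sum_plc f_plc.
have Dcs := diag_closed_subspace X m_gt0.
have Pcs := orthocomplement_closed_subspace (diag_space X m).
have [P0 PD PN PZ] := subspaceP Pcs.
have domE := eff_dom_conj_direct_sum fproper.
have cplc i : proper_lsc_convex (fenchel_conj (f i)).
  apply: conj_plc => //; have [u [+ _]] := standing.
  by rewrite domE => /(_ i) ui; exists (u i).
have cNy i y : (-oo < fenchel_conj (f i) y)%E by have [[+ _] _ _] := cplc i; apply.
apply: attouch_brezis => //.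
case: hyp => [|[|[|[|]]]].
- by rewrite domE.
- move=> [fcoer fcq]; apply: coercive_qualification => //.
    exact: coercive_on_diag.
  by rewrite eff_dom_direct_sum// => i y; have [+ _] := fproper i; apply.
- move=> fT; rewrite domE fT; apply: (@conical_hull_nbhs0 _ _ _ 1) => // w _.
  by exists w => //; exists 0; rewrite ?subr0.
- move=> [x [xP xdom xcont]].
  have /xcont : nbhs (direct_sum (fun i => fenchel_conj (f i)) x) [set y | (y < +oo)%E].
    by apply: open_nbhs_nbhs; split=> //; exact: open_ereal_lt_ereal.
  move=> /nbhs_ballP[d /= d0 dball].
  apply: (@conical_hull_nbhs0 _ _ _ (d / 2)) => [|w wd]; first by rewrite divr_gt0.
  exists (x + w); last by exists x; rewrite // addrC addKr.
  rewrite domE -eff_dom_direct_sum//; apply: dball; rewrite -ball_normE /=.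
  by rewrite opprD addrA subrr sub0r normrN; lra.
- move=> [Xfin [w [wri wP]]]; apply: prodH_finite_dim_closed => //.
  rewrite domE.
  apply: (@relative_interior_cone _ _ _ _ w) => //.
  + move=> x y t t01 xC yC i; rewrite !ffunE.
    have [b xb] := dom_real (xC i); have [b' yb] := dom_real (yC i).
    have [_ _ /(convex_efunP (cNy i)) ccv] := cplc i.
    exact: le_dom (ccv _ _ _ _ _ t01 xb yb).
  + by move=> i; case: (wri i).
  + move=> c cC.
    have /filter_forall/nbhs_ballP[d /= d0 dball] :
        forall i, \forall t \near (0 : R),
          eff_dom (fenchel_conj (f i)) (w i + t *: (w i - c i)).
      by move=> i; exact: relative_interior_extend.
    exists (d / 2); first by rewrite divr_gt0.
    move=> i; rewrite !ffunE; apply: dball; rewrite -ball_normE /=.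
    by rewrite sub0r normrN gtr0_norm; lra.
Qed.
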